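(* Let $X$ be a well-filtered space. Then the Scott power space $\Sigma\,\mathsf{K}(X)$ is well-filtered.
   Context: A subset of a $T_0$ space $X$ is saturated if it equals the intersection of all open sets containing it (equivalently, it is an upper set in the specialization order $x\le y \iff x\in\overline{\{y\}}$). $\mathsf{K}(X)$ denotes the set of all nonempty compact saturated subsets of $X$, ordered by the Smyth order $K_1\sqsubseteq K_2 \iff K_2\subseteq K_1$. For a poset $P$, a subset $U$ is Scott open if $U$ is an upper set and for every (nonempty) directed $D\subseteq P$ whose supremum $\bigvee D$ exists in $P$, $\bigvee D\in U$ implies $D\cap U\neq\emptyset$; these sets form the Scott topology $\sigma(P)$, and $\Sigma P=(P,\sigma(P))$. The Scott power space of $X$ is $\Sigma\,\mathsf{K}(X)=(\mathsf{K}(X),\sigma(\mathsf{K}(X)))$. A $T_0$ space $X$ is well-filtered if for every filtered family $\mathcal K\subseteq \mathsf{K}(X)$ (nonempty, any two members contain a common third member) and every open $U$, $\bigcap\mathcal K\subseteq U$ implies $K\subseteq U$ for some $K\in\mathcal K$. *)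

(* Defs.v *)
From HB Require Import structures.
From mathcomp Require Import all_boot all_order.
From mathcomp Require Import boolp classical_sets topology.

Set Implicit Arguments.
Unset Strict Implicit.
Unset Printing Implicit Defensive.

Import Order.TTheory.

Local Open Scope classical_set_scope.
Local Open Scope order_scope.

Definition saturated (X : topologicalType) (A : set X) : Prop :=
  A = \bigcap_(U in [set U : set X | open U /\ A `<=` U]) U.

(* K(X); [Kset] is boolean-valued so that the type is a [subType] of [set X]. *)
Definition Kset (X : topologicalType) : pred (set X) :=
  fun A => `[< [/\ A !=set0, compact A & saturated A] >].

Record K (X : topologicalType) : Type := MkK {
  Kval :> set X ;
  Kval_prop : Kset Kval
}.

Fact smyth_display : Order.disp_t. Proof. exact: Order.Disp tt tt. Qed.

Section smyth.
Variable X : topologicalType.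

HB.instance Definition _ := [isSub for @Kval X].
HB.instance Definition _ := [Choice of K X by <:].

Definition smyth_le (K1 K2 : K X) : bool := `[< K2 `<=` K1 >].

Lemma smyth_le_refl : reflexive smyth_le.
Proof. by move=> A; apply/asboolP. Qed.

Lemma smyth_le_anti : antisymmetric smyth_le.
Proof.
move=> A B /andP[/asboolP BA /asboolP AB].
by apply: val_inj; apply/seteqP; split.
Qed.

Lemma smyth_le_trans : transitive smyth_le.
Proof.
move=> B A C /asboolP BA /asboolP CB; apply/asboolP.
exact: subset_trans CB BA.
Qed.

HB.instance Definition _ := Order.Le_isPOrder.Build smyth_display (K X)
  smyth_le_refl smyth_le_anti smyth_le_trans.

End smyth.

Section scott.
Context {d : Order.disp_t} {P : porderType d}.

Definition directed (D : set P) : Prop :=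
  D !=set0 /\
  forall x y, D x -> D y -> exists z, [/\ D z, x <= z & y <= z].

(* [supremums D s] says that [s] is the least upper bound of [D], so only
   directed sets having a supremum are tested. *)
Definition scott_open (U : set P) : Prop :=
  (forall x y, x <= y -> U x -> U y) /\
  (forall (D : set P) (s : P),
     directed D -> supremums D s -> U s -> D `&` U !=set0).

Lemma scott_openT : scott_open setT.
Proof. by split=> // D s [D0 _] _ _; rewrite setIT. Qed.

Lemma scott_openI : setI_closed scott_open.
Proof.
move=> U V [upU scU] [upV scV]; split.
  by move=> x y xy [Ux Vx]; split; [exact: upU xy Ux|exact: upV xy Vx].
move=> D s dirD supD [Us Vs].
have [x [Dx Ux]] := scU D s dirD supD Us.
have [y [Dy Vy]] := scV D s dirD supD Vs.
have [z [Dz xz yz]] := dirD.2 x y Dx Dy.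
by exists z; split=> //; split; [exact: upU xz Ux|exact: upV yz Vy].
Qed.

Lemma scott_open_bigU (I : Type) (f : I -> set P) :
  (forall i, scott_open (f i)) -> scott_open (\bigcup_i f i).
Proof.
move=> fo; split.
  by move=> x y xy [i _ fix_]; exists i => //; exact: (fo i).1 xy fix_.
move=> D s dirD supD [i _ fis].
have [x [Dx fx]] := (fo i).2 D s dirD supD fis.
by exists x; split=> //; exists i.
Qed.

End scott.

(* The Scott space of a poset: an alias carrying the Scott topology. *)
Definition Sigma (d : Order.disp_t) (P : porderType d) : Type := P.

Section scott_space.
Variables (d : Order.disp_t) (P : porderType d).

HB.instance Definition _ := Choice.copy (Sigma P) P.
HB.instance Definition _ := isOpenTopological.Build (Sigma P)
  (@scott_openT d P) (@scott_openI d P) (@scott_open_bigU d P).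

Lemma Sigma_openE : (open : set (set (Sigma P))) = @scott_open d P.
Proof. by []. Qed.

End scott_space.

Definition filtered (X : topologicalType) (F : set (K X)) : Prop :=
  F !=set0 /\
  forall K1 K2, F K1 -> F K2 ->
    exists K3, [/\ F K3, K3 `<=` K1 & K3 `<=` K2].

Definition well_filtered (X : topologicalType) : Prop :=
  kolmogorov_space X /\
  forall (F : set (K X)) (U : set X), filtered F -> open U ->
    \bigcap_(A in F) (A : set X) `<=` U ->
    exists2 A : K X, F A & A `<=` U.

(* Main.v *)
Require Import Defs.
From mathcomp Require Import all_boot all_order.
From mathcomp Require Import boolp classical_sets topology.

Local Open Scope classical_set_scope.

(** Write [F] for a filtered family of compact saturated subsets of the Scott
    space of [K X], and [U] for a Scott open set containing none of the members
    of [F]; the task is to find a point of the intersection of [F] outside [U].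

    A topological form of Rudin's lemma (Zorn's lemma and compactness,
    [maximal_open_avoiding]) enlarges [U] to an open set [W] that is maximal
    among the open sets containing no member of [F]. For each [C] in [F], the
    points of [C] outside [W] form a nonempty Scott compact set of compact sets,
    and their union [M_C] is again compact saturated: the Scott topology of
    [K X] contains all boxes [{K | K `<=` V}] with [V] open, because suprema in
    [K X] are intersections when [X] is well-filtered. Each [M_C] lies outside
    the upper set [W], being below the points it is the union of, so the
    directed supremum [M] of the [M_C], which is their intersection, also lies
    outside the Scott open set [W].

    It remains to see that [M] belongs to every [C] in [F]. A point [x] of [M]
    lies in some [K] in [C] outside [W], for every [C]; hence adding to [W] the
    Scott open set [{K | ~ K x}] still produces a set containing no [C], and by
    maximality [W] already contains it. Thus every [K] outside [W] contains [x],
    hence contains [M]. So in each [C] there is a [K] below [M] in the Smyth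
    order, and [C] is an upper set. *)

(** * Compactness and saturation *)

Lemma saturatedP (X : topologicalType) (A : set X) :
  saturated A <->
  forall x, ~ A x -> exists U, [/\ open U, A `<=` U & ~ U x].
Proof.
split=> [satA x nAx|sepA].
  apply: contrapT => nU; apply: nAx; rewrite satA => U [oU AU].
  by apply: contrapT => nUx; apply: nU; exists U.
apply/seteqP; split=> [x Ax U [_ AU]|x Ix]; first exact: AU.
apply: contrapT => nAx; have [U [oU AU nUx]] := sepA x nAx.
by apply: nUx; apply: Ix.
Qed.

Definition directed_cover {X : topologicalType} (S : set (set X)) (A : set X) :=
  [/\ S !=set0, S `<=` open,
      forall U V, S U -> S V -> exists W, [/\ S W, U `<=` W & V `<=` W]
    & A `<=` \bigcup_(U in S) U].

(** Directed covers avoid finite subfamilies altogether, and they are exactly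
    what is transported between a space and its space of compact sets. A filter
    without cluster point in [A] is the same as the directed cover of [A] by the
    complements of the closures of its members. *)
Lemma compact_directedP (X : topologicalType) (A : set X) :
  compact A <->
  forall S, directed_cover S A -> exists2 U, S U & A `<=` U.
Proof.
split=> [cA S [S0 So Sd AS]|dA G PG GA].
  apply: contrapT => nS.
  have ne U : S U -> (A `\` U) !=set0.
    move=> SU; apply: contrapT => nAU; apply: nS; exists U => // x Ax.
    by apply: contrapT => nUx; apply: nAU; exists x.
  pose G := filter_from S (fun U => A `\` U).
  have FG : Filter G.
    apply: filter_from_filter => // U V SU SV.
    have [W [SW UW VW]] := Sd U V SU SV.
    by exists W => // x [Ax nWx]; split; split=> // ?; apply: nWx; auto.
  have PG : ProperFilter G by exact: filter_from_proper.
  have GA : G A by have [U SU] := S0; exists U => // x [].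
  have [x [Ax clx]] := cA G PG GA.
  have [U SU Ux] := AS x Ax.
  have GU : G (A `\` U) by exists U.
  have [y [[_ nUy] Uy]] := clx _ U GU (open_nbhs_nbhs (conj (So U SU) Ux)).
  exact: nUy.
apply: contrapT => ncl.
pose S := [set ~` closure B | B in G].
have [U [B GB <-] AB] : exists2 U, S U & A `<=` U.
  apply: dA; split.
  - by exists (~` closure A); exists A.
  - by move=> _ [B GB <-]; apply: closed_openC; exact: closed_closure.
  - move=> _ _ [B GB <-] [C GC <-]; exists (~` closure (B `&` C)); split.
    + by exists (B `&` C) => //; exact: filterI.
    + by apply: subsetC; apply: closureS => x [].
    + by apply: subsetC; apply: closureS => x [].
  - move=> x Ax; apply: contrapT => nx; apply: ncl; exists x; split=> //.
    rewrite clusterE => B GB; apply: contrapT => nclB; apply: nx.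
    by exists (~` closure B) => //; exists B.
have [x [Ax Bx]] := filter_ex (filterI GA GB).
by apply: (AB x Ax); exact: subset_closure.
Qed.

Section K_facts.
Context {X : topologicalType}.
Implicit Types (A B : K X) (F : set (K X)).

Lemma K_neq0 A : (A : set X) !=set0.
Proof. by have /asboolP[] := Kval_prop A. Qed.

Lemma K_compact A : compact (A : set X).
Proof. by have /asboolP[] := Kval_prop A. Qed.

Lemma K_saturated A : saturated (A : set X).
Proof. by have /asboolP[] := Kval_prop A. Qed.

Lemma K_exists (M : set X) : M !=set0 -> compact M -> saturated M ->
  exists A, A = M :> set X.
Proof.
by move=> M0 cM sM; exists (MkK (introT (asboolP _) (And3 M0 cM sM))).
Qed.

Lemma K_leE A B : (A <= B)%O <-> B `<=` A.
Proof. by split=> [/asboolP|BA]; last exact/asboolP. Qed.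

End K_facts.

Lemma compact_directed_cover {X : topologicalType} {A : set X}
  (S : set (set X)) :
  compact A -> directed_cover S A -> exists2 U, S U & A `<=` U.
Proof. by move=> /compact_directedP; apply. Qed.

(** The union of a chain of open sets containing no member of [F] still contains
    none, by compactness, so Zorn's lemma yields a maximal one above [U].
    Adjoining the empty set to the chain keeps the directed cover nonempty when
    the chain is empty. *)
Lemma maximal_open_avoiding (X : topologicalType) (F : set (K X)) (U : set X) :
  open U -> (forall A, F A -> ~ A `<=` U) ->
  exists W, [/\ open W, U `<=` W, forall A, F A -> ~ A `<=` W
    & forall O, open O -> (forall A, F A -> ~ A `<=` W `|` O) -> O `<=` W].
Proof.
move=> oU avU.
pose P (V : set X) := open V /\ forall A, F A -> ~ A `<=` U `|` V.
have [C CP totC|V [[oV avV] maxV]] := @Zorn_bigcup X P.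
  split; first by apply: bigcup_open => V /CP[].
  move=> A FA AC.
  pose S := [set U `|` V | V in C `|` [set set0]].
  have [_ [V CV <-] AV] : exists2 V, S V & A `<=` V.
    apply: compact_directed_cover; first exact: K_compact.
    split.
    - by exists (U `|` set0); exists set0 => //; right.
    - move=> _ [V [/CP[oV _]|->] <-]; apply: openU => //; exact: open0.
    - move=> _ _ [V CV <-] [V' CV' <-].
      have [VV'|V'V] : V `<=` V' \/ V' `<=` V.
        by case: CV CV' => [CV|->] [CV'|->];
          [exact: totC|right|left|left].
      + exists (U `|` V'); split=> //; first by exists V'.
        exact: setUS.
      + exists (U `|` V); split=> //; first by exists V.
        exact: setUS.
    - move=> x /AC[Ux|[V CV Vx]].
        by exists (U `|` set0); [exists set0 => //; right|left].
      by exists (U `|` V); [exists V => //; left|right].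
  case: CV AV => [/CP[_ av]|->]; first exact: av.
  by rewrite setU0; exact: avU.
exists (U `|` V); split; [exact: openU|exact: subsetUl|exact: avV|].
move=> O oO avO x Ox; apply: contrapT => nx.
apply: (maxV (V `|` O)).
  split; first by move=> y; left.
  by move=> /(_ x (or_intror Ox)) Vx; apply: nx; right.
by split=> [|A FA]; [exact: openU|rewrite setUA; exact: avO].
Qed.

(** * Well-filtered spaces *)

(** Well-filteredness with [U] empty gives nonemptiness of the intersection;
    compactness follows since the union of a directed cover of the intersection
    already contains some member of [F]. *)
Lemma filtered_bigcap_K (X : topologicalType) (F : set (K X)) :
  well_filtered X -> filtered F ->
  exists M : K X, M = \bigcap_(A in F) (A : set X) :> set X.
Proof.
move=> [_ wf] fF; apply: K_exists.
- apply: contrapT => M0.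
  have [|A FA A0] := wf F set0 fF open0.
    by move=> x Mx; apply: M0; exists x.
  by have [x /A0] := K_neq0 A.
- apply/compact_directedP => S [S0 So Sd MS].
  have [A FA AS] := wf F _ fF (bigcup_open So) MS.
  have [V SV AV] := compact_directed_cover S (K_compact A) (And4 S0 So Sd AS).
  by exists V => // x Mx; apply: AV; exact: Mx.
- apply/saturatedP => x nMx.
  have [A FA nAx] : exists2 A, F A & ~ (A : set X) x.
    apply: contrapT => nA; apply: nMx => A FA.
    by apply: contrapT => nAx; apply: nA; exists A.
  have [U [oU AU nUx]] := (saturatedP _ _).1 (K_saturated A) x nAx.
  by exists U; split=> // y My; apply: AU; exact: My.
Qed.

Lemma directed_filtered {X : topologicalType} {F : set (K X)} :
  directed F <-> filtered F.
Proof.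
by split=> -[F0 Fd]; split=> // A B FA FB; have [C [FC AC BC]] := Fd A B FA FB;
  exists C; split=> //; apply/K_leE.
Qed.

Lemma bigcap_supremums {X : topologicalType} {F : set (K X)} {M : K X} :
  M = \bigcap_(A in F) (A : set X) :> set X -> supremums F M.
Proof.
move=> ME; split=> [A FA|B ubB]; apply/K_leE; rewrite ME.
  by move=> x; exact.
by move=> x Bx A FA; have /K_leE := ubB A FA; exact.
Qed.

Lemma supremum_bigcap {X : topologicalType} {F : set (K X)} {s : K X} :
  well_filtered X -> filtered F -> supremums F s ->
  \bigcap_(A in F) (A : set X) `<=` s.
Proof.
move=> wf fF [_ lubs]; have [M ME] := filtered_bigcap_K X F wf fF.
by rewrite -ME; apply/K_leE/lubs; have [] := bigcap_supremums ME.
Qed.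

(** * Two kinds of Scott open sets of compact sets *)

Definition box {X : topologicalType} (U : set X) : set (Sigma (K X)) :=
  [set A : K X | A `<=` U].

Lemma open_box {X : topologicalType} (U : set X) :
  well_filtered X -> open U -> open (box U).
Proof.
move=> wf oU; rewrite Sigma_openE; split=> [A B /K_leE BA AU|D s dD sD sU].
  exact: subset_trans BA AU.
have fD := directed_filtered.1 dD.
have [A DA AU] := wf.2 D U fD oU (subset_trans (supremum_bigcap wf fD sD) sU).
by exists A.
Qed.

(** The complement is Scott closed: containing [x] passes to larger sets and, as
    suprema are intersections, to directed suprema. *)
Lemma open_avoid_point {X : topologicalType} (x : X) :
  well_filtered X -> open ([set A : K X | ~ (A : set X) x] : set (Sigma (K X))).
Proof.
move=> wf; rewrite Sigma_openE.
split=> [A B /K_leE BA nAx /BA //|D s dD sD nsx].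
have fD := directed_filtered.1 dD.
apply: contrapT => nD; apply: nsx; apply: (supremum_bigcap wf fD sD) => A DA.
by apply: contrapT => nAx; apply: nD; exists A.
Qed.

(** The union of a compact family of compact sets is compact: boxes turn a
    directed cover of the union into one of [C]. *)
Lemma compact_bigcup_K {X : topologicalType} {C : set (Sigma (K X))} :
  well_filtered X -> C !=set0 -> compact C ->
  exists M : K X, M = \bigcup_(A in C) (A : K X) :> set X.
Proof.
move=> wf [A0 CA0] cC; apply: K_exists.
- by have [x A0x] := @K_neq0 X A0; exists x; exists A0.
- apply/compact_directedP => S [S0 So Sd MS].
  pose boxes : set (set (Sigma (K X))) := [set box U | U in S].
  have [|_ [U SU <-] CU] := compact_directed_cover boxes cC.
    split.
    + by have [U SU] := S0; exists (box U); exists U.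
    + by move=> _ [U SU <-]; apply: open_box => //; exact: So.
    + move=> _ _ [U SU <-] [V SV <-]; have [W [SW UW VW]] := Sd U V SU SV.
      exists (box W); split; first by exists W.
        by move=> A AU; exact: subset_trans AU UW.
      by move=> A AV; exact: subset_trans AV VW.
    + move=> A CA; have [|U SU AU] := compact_directed_cover S (@K_compact X A).
        by split=> // x Ax; apply: MS; exists A.
      by exists (box U) => //; exists U.
  by exists U => // x [A /CU AU Ax]; exact: AU.
- apply/saturatedP => x nMx.
  pose W := \bigcup_(U in [set U : set X | open U /\ ~ U x]) U.
  exists W; split=> [||[U [_ nUx] Ux]//]; first by apply: bigcup_open => U [].
  move=> y [A CA Ay].
  have [|U [oU AU nUx]] := (saturatedP _ _).1 (@K_saturated X A) x.
    by move=> Ax; apply: nMx; exists A.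
  by exists U => //; exact: AU.
Qed.

Lemma K_Sigma_upper {d : Order.disp_t} {P : porderType d} (C : K (Sigma P))
  (a b : P) : (a <= b)%O -> (C : set (Sigma P)) a -> (C : set (Sigma P)) b.
Proof.
move=> ab Ca; apply: contrapT => nCb.
have [U [oU CU nUb]] := (saturatedP _ _).1 (K_saturated C) b nCb.
by apply: nUb; apply: (oU.1 _ _ ab); exact: CU.
Qed.

Lemma kolmogorov_Sigma {d : Order.disp_t} (P : porderType d) :
  kolmogorov_space (Sigma P).
Proof.
(* The complement of a principal lower set is Scott open. *)
have oC (y : P) : open ([set x : P | ~ (x <= y)%O] : set (Sigma P)).
  rewrite Sigma_openE; split=> [a b ab nay by_|D s _ [_ lubs] nsy].
    by apply: nay; exact: Order.POrderTheory.le_trans ab by_.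
  apply: contrapT => nD; apply: nsy; apply: lubs => a Da.
  by apply: contrapT => nay; apply: nD; exists a.
move=> x y /eqP xy.
have sep (a b : P) : ~ (a <= b)%O ->
    exists A : set (Sigma P), A \in nbhs (a : Sigma P) /\ b \in ~` A.
  move=> nab; exists [set x : P | ~ (x <= b)%O]; split; apply/mem_set.
    by apply: open_nbhs_nbhs; split.
  by move=> /(_ (Order.POrderTheory.lexx b)).
have [xley|nxy] := pselect ((x : P) <= (y : P))%O; last first.
  by have [A AP] := sep _ _ nxy; exists A; left.
have [ylex|nyx] := pselect ((y : P) <= (x : P))%O; last first.
  by have [A AP] := sep _ _ nyx; exists A; right.
by exfalso; apply: xy; apply: Order.POrderTheory.le_anti; rewrite xley ylex.
Qed.

(** * Well-filteredness of the Scott power space *)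

Theorem theorem6p5 (X : topologicalType) (wfX : well_filtered X) :
  well_filtered (Sigma (K X)).
Proof.
split; first exact: kolmogorov_Sigma.
move=> F U fF oU capU; apply: contrapT => nFU.
have [|W [oW UW avW maxW]] := maximal_open_avoiding (Sigma (K X)) F U oU.
  by move=> C FC CU; apply: nFU; exists C.
pose rest (C : K (Sigma (K X))) : set (Sigma (K X)) := C `&` ~` W.
have rest_neq0 C : F C -> rest C !=set0.
  move=> FC; apply: contrapT => r0; apply: (avW C FC) => A CA.
  by apply: contrapT => nWA; apply: r0; exists A.
have cup_rest C : F C ->
    exists M : K X, M = \bigcup_(A in rest C) (A : K X) :> set X.
  move=> FC; apply: compact_bigcup_K => //; first exact: rest_neq0.
  by apply: compact_closedI; [exact: K_compact|exact: open_closedC].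
pose D : set (K X) :=
  [set M | exists2 C, F C & M = \bigcup_(A in rest C) (A : K X) :> set X].
have fD : filtered D.
  split.
    by have [C FC] := fF.1; have [M ME] := cup_rest C FC; exists M; exists C.
  move=> M1 M2 [C1 FC1 ->] [C2 FC2 ->].
  have [C [FC CC1 CC2]] := fF.2 C1 C2 FC1 FC2.
  have [M ME] := cup_rest C FC.
  exists M; split; [by exists C| |];
    rewrite ME; apply: bigcup_subset => A [CA nWA];
    by split=> //; auto.
have [M ME] := filtered_bigcap_K X D wfX fD.
(* [M] is the supremum of [D], and the members of [D] avoid the Scott open
   set [W]. *)
have nWM : ~ W M.
  move=> WM.
  have [N [[C FC NE] WN]] :=
    oW.2 D M (directed_filtered.2 fD) (bigcap_supremums ME) WM.
  have [A [CA nWA]] := rest_neq0 C FC.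
  apply: (nWA); apply: (oW.1 _ _ _ WN); apply/K_leE; rewrite NE.
  by move=> x Ax; exists A.
(* Maximality of [W], applied to the Scott open set of the [A] avoiding a
   point [x] of [M]. *)
have subM (A : K X) : ~ W A -> M `<=` A.
  move=> nWA x Mx; apply: contrapT => nAx; apply: nWA.
  apply: (maxW _ (open_avoid_point x wfX)) nAx => C FC CWx.
  have [N NE] := cup_rest C FC.
  have : (N : set X) x by move: Mx; rewrite ME; apply; exists C.
  by rewrite NE => -[B [/CWx[//|nBx] _] Bx]; exact: nBx.
apply/nWM/UW/capU => C FC.
have [A [CA nWA]] := rest_neq0 C FC.
by apply: (K_Sigma_upper C A M _ CA); apply/K_leE; exact: subM.
Qed.
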